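(* Let $\psi:\mathbb{R}\to\mathbb{R}$ and let $\delta_{\psi}(\mathbf{X})=X_2-\psi(D)$ be a location equivariant estimator of $\theta_2$. Let $l^{(2)}(t)$ and $u^{(2)}(t)$ be functions (values $\pm\infty$ allowed) such that $l^{(2)}(t)\le m^{(2)}_{\lambda}(t)\le u^{(2)}(t)$ for all $\lambda\ge 0$ and any $t$. Define, for each $t$, $\psi^{*}(t)=\max\{l^{(2)}(t),\min\{\psi(t),u^{(2)}(t)\}\}$, and let $\delta_{\psi^{*}}(\mathbf{X})=X_2-\psi^{*}(D)$. If $P_{\boldsymbol\theta}[l^{(2)}(D)\le\psi(D)\le u^{(2)}(D)]<1$ for all $\boldsymbol\theta\in\Theta_0$, then $GPN(\delta_{\psi^{*}},\delta_{\psi};\boldsymbol\theta)>\frac12$ for all $\boldsymbol\theta\in\Theta_0$.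
   Context: $f$ is a specified Lebesgue probability density on $\mathbb{R}^2$, and $\mathbf{X}=(X_1,X_2)$ has joint p.d.f. $f(x_1-\theta_1,x_2-\theta_2)$, where $\boldsymbol\theta=(\theta_1,\theta_2)\in\Theta_0=\{(t_1,t_2)\in\mathbb{R}^2: t_1\le t_2\}$ is unknown. Put $\lambda=\theta_2-\theta_1\ge 0$, $D=X_2-X_1$, $Z_2=X_2-\theta_2$. The p.d.f. of $D$ is $f_D(t|\lambda)=\int_{-\infty}^{\infty}f(y-t+\lambda,y)\,dy$, and the conditional p.d.f. of $Z_2$ given $D=t$ is $f_\lambda(s|t)=f(s-t+\lambda,s)/f_D(t|\lambda)$ ($t$ in the support of $D$). $m^{(2)}_\lambda(t)$ denotes the median of this conditional distribution, so $\int_{-\infty}^{m^{(2)}_\lambda(t)}f(s-t+\lambda,s)\,ds=\frac12\int_{-\infty}^{\infty}f(s-t+\lambda,s)\,ds$. General loss function: $L_2(\boldsymbol\theta,a)=W(a-\theta_2)$, $a\in\mathbb{R}$, where $W:\mathbb{R}\to[0,\infty)$ satisfies $W(0)=0$, $W$ strictly decreasing on $(-\infty,0)$ and strictly increasing on $(0,\infty)$. For estimators $\delta_1,\delta_2$ of $\theta_2$, $GPN(\delta_1,\delta_2;\boldsymbol\theta)=P_{\boldsymbol\theta}[L_2(\boldsymbol\theta,\delta_1)<L_2(\boldsymbol\theta,\delta_2)]+\frac12P_{\boldsymbol\theta}[L_2(\boldsymbol\theta,\delta_1)=L_2(\boldsymbol\theta,\delta_2)]$. All functions defining estimators are understood to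 be Borel measurable.
   Formalization: The loss W is additionally assumed to have equal left and right limits at 0 (automatic if W is continuous there), since otherwise GPN can equal 1/2; if the conditional median is not unique, the bounds l and u are required to hold for every median. *)

(* Defs.v *)
From HB Require Import structures.
From mathcomp Require Import all_boot all_order all_algebra.
From mathcomp Require Import all_classical all_reals all_analysis.
From mathcomp Require Import measurable_realfun.

Set Implicit Arguments.
Unset Strict Implicit.
Unset Printing Implicit Defensive.

Import Order.TTheory GRing.Theory Num.Theory.
Import numFieldNormedType.Exports.

Local Open Scope classical_set_scope.
Local Open Scope ring_scope.

Definition leb2 {R : realType} :=
  ((@lebesgue_measure R) \x (@lebesgue_measure R))%E.

Definition is_pdf2 {R : realType} (f : R * R -> R) : Prop :=
  [/\ measurable_fun setT f, (forall x, 0 <= f x) &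
      (\int[leb2]_x (f x)%:E = 1)%E].

Definition Theta0 {R : realType} : set (R * R) := [set th | th.1 <= th.2].

(* The sample space is R^2 itself, with X the identity, so that a statistic
   is a function on R * R. *)
Definition pdfX {R : realType} (f : R * R -> R) (th x : R * R) : R :=
  f (x.1 - th.1, x.2 - th.2).

Definition Ptheta {R : realType} (f : R * R -> R) (th : R * R)
    (A : set (R * R)) : \bar R :=
  (\int[leb2]_(x in A) (pdfX f th x)%:E)%E.

Definition statD {R : realType} (x : R * R) : R := x.2 - x.1.

Definition pdfD {R : realType} (f : R * R -> R) (lam t : R) : \bar R :=
  (\int[lebesgue_measure]_y (f (y - t + lam, y))%:E)%E.

(* Points at which the density of D is positive.  The integral defining that
   density may be infinite on a Lebesgue-null set of t, where the conditional
   density does not exist; such t are left out. *)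
Definition suppD {R : realType} (f : R * R -> R) (lam : R) : set R :=
  [set t | (0 < pdfD f lam t < +oo)%E].

Definition cond_pdfZ2 {R : realType} (f : R * R -> R) (lam t s : R) : R :=
  f (s - t + lam, s) / fine (pdfD f lam t).

Definition is_cond_median {R : realType} (f : R * R -> R) (lam t m : R) : Prop :=
  (\int[lebesgue_measure]_(s in `]-oo, m]) (cond_pdfZ2 f lam t s)%:E
   = (2^-1)%:E)%E.

Definition is_lossW {R : realType} (W : R -> R) : Prop :=
  [/\ forall x, 0 <= W x, W 0 = 0,
      {in `]-oo, 0[ &, {homo W : x y /~ x < y}} &
      {in `]0, +oo[ &, {homo W : x y / x < y}}].

Definition loss2 {R : realType} (W : R -> R) (th : R * R) (a : R) : R :=
  W (a - th.2).

Definition GPN {R : realType} (f : R * R -> R) (W : R -> R)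
    (delta1 delta2 : R * R -> R) (th : R * R) : \bar R :=
  (Ptheta f th [set x | (loss2 W th (delta1 x) < loss2 W th (delta2 x))%R]
   + (2^-1)%:E *
     Ptheta f th [set x | loss2 W th (delta1 x) = loss2 W th (delta2 x)])%E.

Definition equivariant {R : realType} (psi : R -> R) (x : R * R) : R :=
  x.2 - psi (statD x).

(* The bounds l and u may be infinite.  When l t <= m <= u t for some real m,
   the max-min is finite and [fine] only forgets the embedding R -> \bar R. *)
Definition psi_star {R : realType} (l u : R -> \bar R) (psi : R -> R) (t : R) : R :=
  fine (maxe (l t) (mine (psi t)%:E (u t))).

(* Main.v *)
(* With t = D and s = Z_2 as coordinates, GPN becomes an integral over t of
   P(better | t) + P(equal | t) / 2, weighted by the density of D.  Where psi t
   lies in [l t, u t] the two estimators agree and the weight is exactly 1/2.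
   Where psi t > u t, the clamped estimator has error s - u t, and it is strictly
   better for all s <= u t + e, for some e > 0: to the left of u t by monotonicity of W,
   and slightly to the right because W has the same limit at 0 from both sides.
   The conditional mass of that ray exceeds 1/2, for otherwise u t + e would be
   a conditional median above u t.  The case psi t < l t is symmetric.  Such t
   have positive probability, so the integral is strictly above 1/2. *)

Require Import Defs.
From HB Require Import structures.
From mathcomp Require Import all_boot all_order all_algebra.
From mathcomp Require Import all_classical all_reals all_analysis.
From mathcomp Require Import measurable_realfun.
From mathcomp Require Import ring lra.

Import Order.TTheory GRing.Theory Num.Theory.
Import numFieldNormedType.Exports.

Local Open Scope classical_set_scope.
Local Open Scope ring_scope.

(** * Measurability of the loss and its behaviour near the origin *)

Lemma interval_homo_measurable (R : realType) (D : set R) (f : R -> R) :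
  is_interval D -> (forall x y, D x -> D y -> x <= y -> f x <= f y) ->
  measurable_fun D f.
Proof.
move=> iD ndf; apply: (measurability (@RGenCInfty.G R)) => [|/= _ [_] [r] -> <-].
  exact: RGenCInfty.measurableE.
(* By monotonicity, the points of [D] sent into a ray form an interval again. *)
apply: is_interval_measurable => s t/= [Ds +] [Dt +].
rewrite !in_itv/= !andbT => fs ft u /andP[su ut].
have Du : D u by apply: (iD s t) => //; rewrite su ut.
by split => //=; rewrite in_itv/= andbT (le_trans fs)// ndf.
Qed.

Lemma interval_nhomo_measurable (R : realType) (D : set R) (f : R -> R) :
  is_interval D -> (forall x y, D x -> D y -> x <= y -> f y <= f x) ->
  measurable_fun D f.
Proof.
move=> iD nif; rewrite -(opprK f); apply/measurable_funN.
by apply: interval_homo_measurable => // x y Dx Dy xy; rewrite lerN2 nif.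
Qed.

Lemma lossW_measurable (R : realType) (W : R -> R) :
  is_lossW W -> measurable_fun setT W.
Proof.
case=> _ _ Wn Wp.
(* [W] is monotone only on each open half-line, and its value at [0] may be isolated, so the three
   pieces are treated separately. *)
have -> : [set: R] = `]-oo, 0[ `|` ([set 0] `|` `]0, +oo[).
  apply/seteqP; split => // x _ /=; rewrite !in_itv/= andbT.
  by case: (ltgtP x 0) => h; [left|right; right|right; left].
apply/measurable_funU => //; first exact: measurableU.
split.
  apply: interval_nhomo_measurable; first exact: interval_is_interval.
  move=> x y /= x0 y0; rewrite le_eqVlt => /predU1P[->//|xy].
  by apply/ltW/Wn.
apply/measurable_funU => //; split; first exact: measurable_fun_set1.
apply: interval_homo_measurable; first exact: interval_is_interval.
move=> x y /= x0 y0; rewrite le_eqVlt => /predU1P[->//|xy].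
by apply/ltW/Wp.
Qed.

(* A common limit of [W] at [0] from both sides puts the values just right of
   [0] below the value at any fixed negative point. *)
Lemma lossW_lt_left (R : realType) (W : R -> R) (a b : R) :
  is_lossW W -> cvg (W x @[x --> (0 : R)^']) -> a < b ->
  exists2 e, 0 < e & forall s, s <= a + e -> W (s - a) < W (s - b).
Proof.
move=> [W0 W00 Wn Wp] cW ab.
have negW x y : x < y -> y < 0 -> W y < W x.
  by move=> xy y0; apply: Wn => //; rewrite in_itv/= ?(lt_trans xy).
(* [d] is half the gap between [a] and [b]. The drop [eta] of [W] from [- d] to [- (d / 2)] is the
   slack that absorbs the oscillation of [W] around its limit at [0]. *)
pose d := (b - a) / 2.
have d0 : 0 < d by rewrite divr_gt0// subr_gt0.
pose eta := W (- d) - W (- (d / 2)).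
have eta0 : 0 < eta by rewrite subr_gt0; apply: negW; rewrite /d; lra.
pose c := lim (W x @[x --> (0 : R)^']).
have /cvgrPdist_lt/(_ (eta / 2)) := (cW : W x @[x --> (0 : R)^'] --> c).
rewrite divr_gt0// => /(_ isT).
rewrite near_withinE => -[/= e e0 near].
have close y : y != 0 -> `|y| < e -> `|c - W y| < eta / 2.
  by move=> y0 ye; apply: near => //=; rewrite sub0r normrN.
(* The bound [e / 2] keeps [s - a] strictly within the radius [e] where [W] is close to its limit;
   the bound [d] keeps [s - b] at most [- d]. *)
exists (Num.min (e / 2) d); first by rewrite lt_min d0 divr_gt0.
move=> s sa.
have [sae|eas|->] := ltgtP s a.
- by apply: negW; lra.
- have /andP[se sd] : (s - a <= e / 2) && (s - a <= d).
    by rewrite -le_min lerBlDl.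
  (* [y0] is a negative point within that radius and not left of [- (d / 2)]. Then [W (s - a) < W y0
     + eta <= W (- (d / 2)) + eta = W (- d) <= W (s - b)]. *)
  pose y0 := - Num.min (d / 2) (e / 2).
  have y0lt : y0 < 0 by rewrite oppr_lt0 lt_min; apply/andP; split; lra.
  have y0e : `|y0| < e.
    rewrite ltr0_norm// opprK gt_min; apply/orP; right; lra.
  have y0d : - (d / 2) <= y0 by rewrite lerN2 ge_min lexx.
  have h1 : W y0 <= W (- (d / 2)).
    by move: y0d; rewrite le_eqVlt => /predU1P[->//|?]; apply/ltW/negW.
  have h2 : W (- d) <= W (s - b).
    have : s - b <= - d by rewrite /d; move: sd; rewrite /d; lra.
    rewrite le_eqVlt => /predU1P[->//|?]; apply/ltW/negW => //; lra.
  have := close y0 (negbT (lt_eqF y0lt)) y0e.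
  have sa0 : 0 < s - a by rewrite subr_gt0.
  have := close (s - a) (negbT (gt_eqF sa0)).
  rewrite gtr0_norm// => /(_ ltac:(lra)).
  by rewrite !ltr_norml /eta => /andP[? ?] /andP[? ?]; rewrite /eta in h1 *; lra.
(* At [s = a] the claim is [0 < W (a - b)]: [W] is nonnegative at the midpoint of [a - b] and [0],
   and strictly larger at [a - b]. *)
- rewrite subrr W00.
  by apply: (le_lt_trans (W0 ((a - b) / 2))); apply: negW; lra.
Qed.

(** Reflection carries the comparison to the left of a point over to its right. *)
Lemma lossW_opp (R : realType) (W : R -> R) :
  is_lossW W -> is_lossW (fun x => W (- x)).
Proof.
case=> W0 W00 Wn Wp; split => [x||x y|x y]; rewrite ?oppr0// !in_itv/= ?andbT.
- by move=> *; apply: Wp; rewrite ?in_itv/= ?andbT ?oppr_gt0 ?ltrN2.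
- by move=> *; apply: Wn; rewrite ?in_itv/= ?oppr_lt0 ?ltrN2.
Qed.

Lemma lossW_lt_right (R : realType) (W : R -> R) (a b : R) :
  is_lossW W -> cvg (W x @[x --> (0 : R)^']) -> b < a ->
  exists2 e, 0 < e & forall s, a - e <= s -> W (s - a) < W (s - b).
Proof.
move=> hW cW ba.
have cWN : cvg (W (- x) @[x --> (0 : R)^']).
  apply/cvg_ex; exists (lim (W x @[x --> (0 : R)^'])).
  apply/cvgrPdist_lt => e e0.
  have /cvgrPdist_lt/(_ e e0) := (cW : W x @[x --> (0 : R)^'] --> lim (W x @[x --> (0 : R)^'])).
  rewrite !near_withinE => -[/= r r0 near]; exists r => //= y.
  rewrite /= sub0r normrN => yr y0; apply: near; rewrite ?oppr_eq0//=.
  by rewrite sub0r opprK.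
have ab : - a < - b by rewrite ltrN2.
have [e e0 h] := lossW_lt_left _ _ _ _ (lossW_opp _ _ hW) cWN ab.
exists e => // s sa; have := h (- s).
rewrite !opprB !opprK ![_ + s]addrC; apply; lra.
Qed.

(** * Masses of rays and existence of quantiles *)

Section ray_integrals.
Variables (R : realType) (g : R -> \bar R).
Hypotheses (mg : measurable_fun setT g) (g0 : forall x, (0 <= g x)%E).
Local Notation mu := (@lebesgue_measure R).
Local Open Scope ereal_scope.

(** Monotone convergence along increasing sets; it passes a bound on closed or open rays to an open
    ray or to the whole line. *)
Lemma integral_bigcup_le (F : (set R)^nat) (q : \bar R) :
  nondecreasing_seq F -> (forall n, measurable (F n)) ->
  (forall n, \int[mu]_(x in F n) g x <= q) ->
  \int[mu]_(x in \bigcup_n F n) g x <= q.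
Proof.
move=> ndF mF Fq.
have cF : \int[mu]_(x in F n) g x @[n --> \oo] --> \int[mu]_(x in \bigcup_n F n) g x.
  apply: ge0_nondecreasing_set_cvg_integral => // n.
  exact: measurable_funTS.
rewrite -(cvg_lim _ cF)//; apply: lime_le; first by apply/cvg_ex; eexists; exact: cF.
exact: nearW.
Qed.

Lemma integral_ray_split (x : R) : \int[mu]_y g y =
  \int[mu]_(y in `]-oo, x]) g y + \int[mu]_(y in `]x, +oo[) g y.
Proof.
have E : `]-oo, x] `|` `]x, +oo[ = [set: R] by rewrite -setCitvl setUv.
rewrite -ge0_integral_setU//= ?E//.
by rewrite -setCitvl disj_set2E setICr.
Qed.

Lemma le_integral_ray (x y : R) : (x <= y)%R ->
  \int[mu]_(z in `]-oo, x]) g z <= \int[mu]_(z in `]-oo, y]) g z.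
Proof.
move=> xy; apply: ge0_subset_integral => //; first exact: measurable_funTS.
by apply: subset_itvl; rewrite bnd_simp.
Qed.

Let bigcup_ub : \bigcup_n `]-oo, n%:R]%classic = [set: R].
Proof.
apply/seteqP; split => // x _; exists (Num.truncn x).+1 => //=.
by rewrite in_itv/= ltW// truncnS_gt.
Qed.

Let bigcup_lb : \bigcup_n `](- n%:R)%R, +oo[%classic = [set: R].
Proof.
apply/seteqP; split => // x _; exists (Num.truncn (- x)%R).+1 => //=.
by rewrite in_itv/= andbT ltrNl truncnS_gt.
Qed.

(** The supremum of the points whose lower ray has mass at most [q] works, because Lebesgue measure
    has no atoms and the mass of the ray is therefore continuous in its endpoint. *)
Lemma quantile_exists (q : R) : (0 < q)%R -> q%:E < \int[mu]_y g y ->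
  \int[mu]_y g y < +oo -> exists m : R, \int[mu]_(y in `]-oo, m]) g y = q%:E.
Proof.
move=> q0 qp poo.
pose G (x : R) := \int[mu]_(y in `]-oo, x]) g y.
set p := \int[mu]_y g y in qp poo.
have p0 : 0 <= p by apply: integral_ge0.
have pE : p = (fine p)%:E by rewrite fineK// ge0_fin_numE.
have split x : p = G x + \int[mu]_(y in `]x, +oo[) g y := integral_ray_split x.
have G0 x : 0 <= G x by apply: integral_ge0.
(* If no lower ray exceeded mass [q], their union, the whole line, would not either. *)
have [b qb] : exists b, q%:E < G b.
  apply: contrapT => /forallNP nb.
  suff : p <= q%:E by rewrite leNgt qp.
  rewrite /p -bigcup_ub; apply: integral_bigcup_le => //.
    move=> m n mn; apply/subsetPset/subset_itvl.
    by rewrite bnd_simp ler_nat.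
  by move=> n; rewrite leNgt; apply/negP/nb.
have gtG x r : r%:E < G x -> \int[mu]_(y in `]x, +oo[) g y <= p - r%:E.
  move=> rG; rewrite (split x) addeAC leeDr// sube_ge0 ?ltW//.
(* If every lower ray exceeded mass [q], every upper ray would have mass at most [p - q], and so
   would the whole line. *)
have [a aq] : exists a, G a <= q%:E.
  apply: contrapT => /forallNP na.
  suff : p <= p - q%:E.
    by apply/negP; rewrite -ltNge pE -EFinB lte_fin ltrBlDl ltrDr.
  rewrite {1}/p -bigcup_lb; apply: integral_bigcup_le => //.
    move=> m n mn; apply/subsetPset/subset_itvr.
    by rewrite bnd_simp lerN2 ler_nat.
  by move=> n; apply: gtG; rewrite ltNge; apply/negP/na.
pose S := [set x | G x <= q%:E].
have ubS : ubound S b.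
  move=> x Sx; rewrite leNgt; apply/negP => bx.
  have := le_trans (le_integral_ray _ _ (ltW bx)) Sx.
  by rewrite leNgt qb.
have supS : has_sup S by split; [exists a|exists b].
pose m := sup S; exists m; apply/eqP; rewrite eq_le; apply/andP; split.
  (* The endpoint is null, and the open ray is exhausted by rays ending at [m - 1/(n+1)], each of
     which ends before some element of [S]. *)
  rewrite -integral_itv_bndo_bndc; last exact: measurable_funTS.
  rewrite (_ : `]-oo, m[%classic = \bigcup_n `]-oo, (m - n.+1%:R^-1)%R]%classic).
    apply: integral_bigcup_le => //.
      move=> i j ij; apply/subsetPset/subset_itvl.
      by rewrite bnd_simp lerB// lef_pV2 ?posrE// ler_nat.
    move=> n; have [|x Sx mx] := @sup_adherent _ S n.+1%:R^-1 _ supS; first by [].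
    exact: le_trans (le_integral_ray _ _ (ltW mx)) Sx.
  apply/seteqP; split => x /=; rewrite in_itv/=.
    move=> xm; have /ltr_add_invr[k] : (x < m)%R by [].
    by move=> xkm; exists k => //=; rewrite in_itv/= lerBrDr ltW.
  move=> [k _]/=; rewrite in_itv/= => /le_lt_trans; apply.
  by rewrite ltrBlDr ltrDl.
(* For the reverse inequality, the mass above [m] is bounded by exhausting it with rays that start
   at [m + 1/(n+1)], a point outside [S]. *)
suff : \int[mu]_(y in `]m, +oo[) g y <= p - q%:E.
  have := split m; rewrite -/(G m) => ->.
  have : G m < +oo.
    apply: le_lt_trans poo; rewrite (split m) leeDl// integral_ge0//.
  have := G0 m; case: (G m) => // r r0 _.
  have : \int[mu]_(y in `]m, +oo[) g y < +oo.
    by apply: le_lt_trans poo; rewrite (split m) leeDr.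
  have : 0 <= \int[mu]_(y in `]m, +oo[) g y by apply: integral_ge0.
  case: (\int[mu]_(y in `]m, +oo[) g y) => // s s0 _.
  by rewrite -EFinD !lee_fin; lra.
rewrite (_ : `]m, +oo[%classic = \bigcup_n `](m + n.+1%:R^-1)%R, +oo[%classic).
  apply: integral_bigcup_le => //.
    move=> i j ij; apply/subsetPset/subset_itvr.
    by rewrite bnd_simp lerD2l lef_pV2 ?posrE// ler_nat.
  move=> n; apply: gtG; rewrite ltNge; apply/negP => Sm.
  have := sup_upper_bound supS; move=> /(_ _ Sm).
  by apply/negP; rewrite -ltNge ltrDl.
apply/seteqP; split => x /=; rewrite in_itv/= andbT.
  move=> /ltr_add_invr[k] mkx.
  by exists k => //=; rewrite in_itv/= andbT.
move=> [k _]/=; rewrite in_itv/= andbT; apply: lt_trans.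
by rewrite ltrDl.
Qed.

End ray_integrals.

(** * Mass of a ray that extends past all medians *)

Section beyond_median.
Variables (R : realType) (g : R -> \bar R) (p : R).
Hypotheses (mg : measurable_fun setT g) (g0 : forall x, (0 <= g x)%E).
Local Notation mu := (@lebesgue_measure R).
Hypotheses (p0 : 0 < p) (gp : (\int[mu]_y g y = p%:E)%E).
Local Open Scope ereal_scope.

(** Half of the total mass [p], not [1/2]: the density [g] is left unnormalised. *)
Let med m := \int[mu]_(y in `]-oo, m]) g y = (p / 2)%:E.

Let med_exists : exists m, med m.
Proof.
apply: quantile_exists => //; first by rewrite divr_gt0.
- by rewrite gp lte_fin ltr_pdivrMr// ltr_pMr// ltr1n.
- by rewrite gp ltry.
Qed.

(* If the mass below [r + e] were exactly half, [r + e] would be a median. *)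
Lemma integral_gt_half_left (r e : R) : (0 < e)%R ->
  (forall m, med m -> (m <= r)%R) ->
  (p / 2)%:E < \int[mu]_(y in `]-oo, (r + e)%R]) g y.
Proof.
move=> e0 hr; have [m medm] := med_exists.
rewrite lt_neqAle; apply/andP; split.
  apply/eqP => /esym /hr; apply/negP; rewrite -ltNge; lra.
rewrite -[leLHS]medm; apply: le_integral_ray => //.
by have := hr _ medm; lra.
Qed.

(** The mass up to [r - e] is below half, since equality would make [r - e] a median below [r]; the
    complementary ray carries the rest. *)
Lemma integral_gt_half_right (r e : R) : (0 < e)%R ->
  (forall m, med m -> (r <= m)%R) ->
  (p / 2)%:E < \int[mu]_(y in `](r - e)%R, +oo[) g y.
Proof.
move=> e0 hr; have [m medm] := med_exists.
have : \int[mu]_(y in `]-oo, (r - e)%R]) g y < (p / 2)%:E.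
  rewrite lt_neqAle; apply/andP; split.
    by apply/eqP => /hr; apply/negP; rewrite -ltNge; lra.
  rewrite -[leRHS]medm; apply: le_integral_ray => //.
  by have := hr _ medm; lra.
have := integral_ray_split _ _ mg g0 (r - e); rewrite gp.
have : 0 <= \int[mu]_(y in `]-oo, (r - e)%R]) g y by apply: integral_ge0.
have : 0 <= \int[mu]_(y in `](r - e)%R, +oo[) g y by apply: integral_ge0.
case: (\int[mu]_(y in `]-oo, (r - e)%R]) g y) => // a.
case: (\int[mu]_(y in `](r - e)%R, +oo[) g y) => // b.
by rewrite -EFinD !lte_fin => _ _ []; lra.
Qed.

End beyond_median.

(** * Translations, reflection and the passage to the coordinates D and Z_2 *)

Section change_of_variables.
Variable R : realType.
Local Notation mu := (@lebesgue_measure R).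
Local Open Scope ereal_scope.

(** Lebesgue measure is determined by its values on half-open intervals, whose lengths are
    translation invariant. *)
Lemma lebesgue_measure_shift (c : R) (A : set R) : measurable A ->
  pushforward mu ((fun x => x + c)%R : _ -> measurableTypeR R) A = mu A.
Proof.
move=> mA; apply/esym.
have mf : measurable_fun setT ((fun x => x + c)%R : measurableTypeR R -> measurableTypeR R).
  exact: measurable_funD.
pose f : {mfun measurableTypeR R >-> measurableTypeR R} :=
  HB.pack ((fun x => x + c)%R : measurableTypeR R -> measurableTypeR R)
    (isMeasurableFun.Build _ _ _ _ _ mf).
apply: (@lebesgue_measure_unique R (pushforward mu f)) => //= _ [[a b]] _ <-.
rewrite /pushforward (_ : _ @^-1` _ = `](a - c)%R, (b - c)%R]%classic).
  by rewrite !lebesgue_measure_itv/= !lte_fin ltrD2r -!EFinB opprB addrA subrK.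
by apply/seteqP; split => x /=; rewrite !in_itv/= ltrBlDr lerBrDr.
Qed.

Lemma ge0_integral_shift (c : R) (g : R -> \bar R) :
  measurable_fun setT g -> (forall x, 0 <= g x) ->
  \int[mu]_x g (x + c)%R = \int[mu]_x g x.
Proof.
move=> mg g0.
have mf : measurable_fun setT ((fun x => x + c)%R : measurableTypeR R -> measurableTypeR R).
  exact: measurable_funD.
have := ge0_integral_pushforward mf mu measurableT mg (fun x _ => g0 x).
rewrite preimage_setT => <-.
by apply: eq_measure_integral => A mA _; exact: lebesgue_measure_shift.
Qed.

Lemma ge0_integral_opp (g : R -> \bar R) :
  measurable_fun setT g -> (forall x, 0 <= g x) ->
  \int[mu]_x g (- x)%R = \int[mu]_x g x.
Proof.
move=> mg g0.
have mf : measurable_fun setT (-%R : measurableTypeR R -> measurableTypeR R).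
  by [].
have := ge0_integral_pushforward mf mu measurableT mg (fun x _ => g0 x).
rewrite preimage_setT => <-.
by apply: eq_measure_integral => A mA _; exact: lebesgue_measureN.
Qed.

(** The sample point at which [statD] is [t] and the second coordinate minus [b] is [s]; with
    [b = th.2], [s] is the value of Z_2. *)
Definition shear (b : R) (ts : R * R) : R * R :=
  (ts.2 + b - ts.1, ts.2 + b)%R.

Lemma measurable_shear (b : R) : measurable_fun setT (shear b).
Proof.
by apply: measurable_fun_pair; [apply: measurable_funB|]; rewrite //;
  apply: measurable_funD.
Qed.

(** The change of variables has Jacobian of modulus one. It is split into one-dimensional steps:
    substitute [y - t] for the first coordinate, exchange the integrals, then translate the second
    coordinate by [b]. *)
Lemma ge0_integral_shear (b : R) (h : R * R -> \bar R) :
  measurable_fun setT h -> (forall x, 0 <= h x) ->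
  \int[leb2]_x h x = \int[mu]_t \int[mu]_s h (shear b (t, s)).
Proof.
move=> mh h0.
have mhs c : measurable_fun setT (h \o shear c).
  by apply: measurableT_comp => //; exact: measurable_shear.
rewrite /leb2 (fubini_tonelli2 (m1 := mu) (m2 := mu) h mh h0).
transitivity (\int[mu]_y \int[mu]_t h (shear 0 (t, y))).
  apply: eq_integral => y _; rewrite /fubini_G.
  have mhy : measurable_fun setT (fun x => h (x, y)) by exact: measurableT_comp.
  rewrite -[LHS](ge0_integral_shift y)//.
  rewrite -[LHS]ge0_integral_opp//; last first.
    by apply: (measurableT_comp mhy); exact: measurable_funD.
  by apply: eq_integral => t _; rewrite /shear/= addr0 [(- t + y)%R]addrC.
have := fubini_tonelli (m1 := mu) (m2 := mu) (h \o shear 0%R) (mhs 0%R)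
  (fun x => h0 (shear 0%R x)).
move=> /esym ->; apply: eq_integral => t _.
rewrite -[LHS](ge0_integral_shift b).
- by apply: eq_integral => s _; rewrite /shear/= addr0.
- exact: (measurableT_comp (mhs 0%R)).
- by move=> x; exact: h0.
Qed.

End change_of_variables.

(** * Strict monotonicity of the integral *)

Lemma ae_lt_integral d (T : measurableType d) (R : realType)
    (mu : {measure set T -> \bar R}) (f g : T -> \bar R) :
  measurable_fun setT f -> measurable_fun setT g ->
  (forall x, 0 <= f x)%E -> (forall x, 0 <= g x)%E ->
  (\int[mu]_x f x < +oo)%E -> {ae mu, forall x, (f x <= g x)%E} ->
  ~ {ae mu, forall x, f x = g x} ->
  (\int[mu]_x f x < \int[mu]_x g x)%E.
Proof.
(* The reverse inequality makes [g] integrable too; then [g - f] is nonnegative almost everywhere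
   with integral at most zero, so it vanishes almost everywhere. *)
move=> mf mg f0 g0 foo fg nfg; rewrite ltNge; apply/negP => gf; apply: nfg.
have intf : mu.-integrable setT f.
  by apply/integrableP; split => //; under eq_integral do rewrite gee0_abs//.
have intg : mu.-integrable setT g.
  apply/integrableP; split => //; under eq_integral do rewrite gee0_abs//.
  exact: le_lt_trans foo.
have ff := integrable_ae measurableT intf.
have gg := integrable_ae measurableT intg.
have mgf : measurable_fun setT (fun x => g x - f x)%E by exact: emeasurable_funB.
suff /(ae_eq_integral_abs mu measurableT mgf) gf0 :
    (\int[mu]_x `|g x - f x| = 0)%E.
  move: ff gg gf0; apply: filterS3 => x /(_ I) fx /(_ I) gx /(_ I) /eqP.
  by rewrite sube_eq ?add0e// => /eqP.
apply/eqP; rewrite eq_le integral_ge0 ?andbT//.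
rewrite (@ae_eq_integral _ _ _ mu setT (fun x => g x - f x)%E)//.
- by rewrite integralB// sube_le0.
- exact: measurableT_comp.
- move: ff fg; apply: filterS2 => x /(_ I) fx fgx _.
  by rewrite gee0_abs// sube_ge0// fx.
Qed.

(** * Disintegration of the sampling distribution along D *)

Section bivariate_density.
Variables (R : realType) (f : R * R -> R).
Hypothesis hf : is_pdf2 f.
Local Notation mu := (@lebesgue_measure R).
Local Open Scope ereal_scope.

Let mf : measurable_fun setT f. Proof. by case: hf. Qed.
Let f0 x : (0 <= f x)%R. Proof. by case: hf. Qed.

(** The joint density of D and Z_2, which is also the numerator of [cond_pdfZ2]. Using it avoids
    dividing by a density of D that may be zero or infinite. *)
Definition slice (lam t s : R) : \bar R := (f (s - t + lam, s)%R)%:E.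

Lemma slice_ge0 lam t s : 0 <= slice lam t s.
Proof. by rewrite lee_fin. Qed.

Let mfE : measurable_fun setT (EFin \o f). Proof. exact/measurable_EFinP. Qed.

Lemma measurable_slice lam t : measurable_fun setT (slice lam t).
Proof.
apply: (measurableT_comp mfE); apply: measurable_fun_pair => //.
by do 2 apply: measurable_funD => //.
Qed.

Lemma measurable_pdfX th : measurable_fun setT (fun x => (pdfX f th x)%:E).
Proof.
apply: (measurableT_comp mfE); apply: measurable_fun_pair => //;
  exact: measurable_funB.
Qed.

(** Extension by zero outside [A] turns [Ptheta] into an integral over the whole plane, to which the
    shear applies. *)
Let pdfX_patch th A : R * R -> \bar R := (fun x => (pdfX f th x)%:E) \_ A.

Let pdfX_patch_ge0 th A x : 0 <= pdfX_patch th A x.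
Proof. by rewrite /pdfX_patch; apply: erestrict_ge0 => y _; rewrite lee_fin; exact: f0. Qed.

Let measurable_pdfX_patch th A : measurable A ->
  measurable_fun setT (pdfX_patch th A).
Proof.
move=> mA; apply/(measurable_restrictT _ mA)/measurable_funTS.
exact: measurable_pdfX.
Qed.

Let fiber (b : R) (A : set (R * R)) (t : R) := [set s | A (shear R b (t, s))].

Let pdfX_patch_fiber th A t :
  \int[mu]_s pdfX_patch th A (shear R th.2 (t, s)) =
  \int[mu]_(s in fiber th.2 A t) slice (th.2 - th.1) t s.
Proof.
rewrite [RHS]integral_mkcond; apply: eq_integral => s _.
rewrite /pdfX_patch !patchE; congr (if _ then _ else _).
by rewrite /slice /pdfX/=; congr (f (pair _ _))%:E; ring.
Qed.

Lemma measurable_fiber_integral th A : measurable A ->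
  measurable_fun setT
    (fun t => \int[mu]_(s in fiber th.2 A t) slice (th.2 - th.1) t s).
Proof.
move=> mA; under eq_fun do rewrite -pdfX_patch_fiber.
apply: (measurable_fun_fubini_tonelli_F (m2 := mu) (pdfX_patch th A \o shear R th.2)).
  by apply: measurableT_comp (measurable_shear _ _) => //; exact: measurable_pdfX_patch.
by move=> x /=.
Qed.

(** Where the density of D is positive and finite, the inner integral is that density times the
    conditional probability of [A] given D = [t]. *)
Lemma Ptheta_fiber th A : measurable A ->
  Ptheta f th A =
  \int[mu]_t \int[mu]_(s in fiber th.2 A t) slice (th.2 - th.1) t s.
Proof.
move=> mA; rewrite /Ptheta integral_mkcond.
apply: etrans (ge0_integral_shear R th.2 (pdfX_patch th A) _ _) _.
- exact: measurable_pdfX_patch.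
- exact: pdfX_patch_ge0.
- by apply: eq_integral => t _; exact: pdfX_patch_fiber.
Qed.

Lemma pdfD_ge0 lam t : 0 <= pdfD f lam t.
Proof. by apply: integral_ge0 => s _; exact: slice_ge0. Qed.

Let pdfD_shear t : pdfD f 0 t = \int[mu]_s (f (shear R 0 (t, s)))%:E.
Proof.
by apply: eq_integral => s _; rewrite /shear/=; congr (f (pair _ _))%:E; ring.
Qed.

(** This reduces measurability and total mass of [pdfD] to [lam = 0], where the integrand is [f]
    composed with a shear. *)
Let pdfD_shift lam t : pdfD f lam t = pdfD f 0 (t - lam).
Proof.
by apply: eq_integral => s _; rewrite /shear/=; congr (f (pair _ _))%:E; ring.
Qed.

Let measurable_pdfD0 : measurable_fun setT (pdfD f 0).
Proof.
rewrite (funext pdfD_shear).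
apply: (measurable_fun_fubini_tonelli_F (m2 := mu) ((EFin \o f) \o shear R 0)).
  by apply: measurableT_comp => //; exact: measurable_shear.
by move=> x /=; rewrite lee_fin.
Qed.

Lemma measurable_pdfD lam : measurable_fun setT (pdfD f lam).
Proof.
rewrite (funext (pdfD_shift lam)).
apply: (measurableT_comp measurable_pdfD0); exact: measurable_funB.
Qed.

Lemma integral_pdfD lam : \int[mu]_t pdfD f lam t = 1.
Proof.
under eq_integral do rewrite pdfD_shift.
rewrite (ge0_integral_shift _ (- lam) (pdfD f 0))//; last exact: pdfD_ge0.
under eq_integral do rewrite pdfD_shear.
by rewrite -[LHS](ge0_integral_shear _ 0%R (EFin \o f))//; case: hf.
Qed.

(** An integrable function is finite almost everywhere, so leaving infinite densities out of [suppD]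
    costs only a null set. *)
Lemma pdfD_ae_lty lam : {ae mu, forall t, pdfD f lam t < +oo}.
Proof.
have : mu.-integrable setT (pdfD f lam).
  apply/integrableP; split; first exact: measurable_pdfD.
  under eq_integral do rewrite gee0_abs ?pdfD_ge0//.
  by rewrite integral_pdfD ltry.
move=> /(integrable_ae measurableT); apply: filterS => t /(_ I).
by rewrite ge0_fin_numE// pdfD_ge0.
Qed.

(** On [suppD] the normalising constant is positive and finite and can be cleared. *)
Lemma cond_medianE lam t m : suppD f lam t ->
  is_cond_median f lam t m <->
  \int[mu]_(s in `]-oo, m]) slice lam t s = (fine (pdfD f lam t) / 2)%:E.
Proof.
move=> /andP[p0 poo]; rewrite /is_cond_median.
have : (0 < fine (pdfD f lam t))%R by rewrite fine_gt0// p0.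
set p := fine _ => pp.
rewrite /cond_pdfZ2 -/p.
have -> : \int[mu]_(s in `]-oo, m]) (f (s - t + lam, s)%R / p)%:E =
    (p^-1)%:E * \int[mu]_(s in `]-oo, m]) slice lam t s.
  rewrite -ge0_integralZl_EFin ?invr_ge0 ?ltW//.
  - by apply: eq_integral => s _; rewrite muleC.
  - by move=> s _; exact: slice_ge0.
  - by apply: measurable_funTS; exact: measurable_slice.
(* For an infinite ray mass both sides of the equivalence are false. *)
case: (\int[mu]_(s in _) _) => [a||].
- have pn0 : p != 0%R by rewrite gt_eqF.
  rewrite -EFinM; split => -[].
    by move=> <-; rewrite mulrA mulfV// mul1r.
  by move=> ->; rewrite mulrA mulVf// mul1r.
- by rewrite gt0_muley// lte_fin invr_gt0.
- by rewrite gt0_muleNy// lte_fin invr_gt0.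
Qed.

End bivariate_density.

(** * Measurability of events, and the values of the clamped estimator *)

Lemma measurable_lt_set d (T : measurableType d) (R : realType) (F G : T -> R) :
  measurable_fun setT F -> measurable_fun setT G ->
  measurable [set x | F x < G x].
Proof.
move=> mF mG; have := @measurable_lte _ T R setT measurableT (EFin \o F) (EFin \o G).
rewrite setTI; under eq_set do rewrite lte_fin.
by apply; exact/measurable_EFinP.
Qed.

Lemma measurable_eq_set d (T : measurableType d) (R : realType) (F G : T -> R) :
  measurable_fun setT F -> measurable_fun setT G ->
  measurable [set x | F x = G x].
Proof.
move=> mF mG; have := @measurable_eqe _ T R setT measurableT (EFin \o F) (EFin \o G).
rewrite setTI (_ : [set x | _ = _] = [set x | F x = G x]).
  by apply; exact/measurable_EFinP.
by apply/seteqP; split => x /= => [[]|->].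
Qed.

Section clamped_estimator.
Variables (R : realType) (l u : R -> \bar R) (psi : R -> R) (t m : R).
Hypothesis lmu : (l t <= m%:E <= u t)%E.
Local Notation psis := (psi_star l u psi t).

Lemma psi_star_inside : (l t <= (psi t)%:E <= u t)%E -> psis = psi t.
Proof.
by move=> /andP[lp pu]; rewrite /psi_star (min_idPl pu) (max_idPr lp).
Qed.

(** The real number [m] keeps [u t] above minus infinity and [psi t] keeps it below plus infinity,
    so [fine] loses nothing; [l t <= u t] makes the outer maximum inert. *)
Lemma psi_star_above : (u t < (psi t)%:E)%E -> u t = psis%:E.
Proof.
move=> up; have /andP[lm mu] := lmu.
rewrite /psi_star (min_idPr (ltW up)) (max_idPr (le_trans lm mu)) fineK//.
rewrite fin_real// (lt_le_trans (ltNyr m) mu)/= (lt_trans up)// ltry.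
by [].
Qed.

Lemma psi_star_below : ((psi t)%:E < l t)%E -> l t = psis%:E.
Proof.
move=> pl; have /andP[lm mu] := lmu.
have pu : ((psi t)%:E <= u t)%E by rewrite ltW// (lt_le_trans pl)// (le_trans lm).
rewrite /psi_star (min_idPl pu) (max_idPl (ltW pl)) fineK//.
by rewrite fin_real// (lt_trans (ltNyr _) pl) (le_lt_trans lm)// ltry.
Qed.

End clamped_estimator.

Lemma measurable_psi_star (R : realType) (l u : R -> \bar R) (psi : R -> R) :
  measurable_fun setT l -> measurable_fun setT u -> measurable_fun setT psi ->
  measurable_fun setT (psi_star l u psi).
Proof.
move=> ml mu mpsi; apply: (measurableT_comp (@fine_measurable R setT measurableT)).
apply: measurable_maxe => //; apply: measurable_mine => //.
exact/measurable_EFinP.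
Qed.

Lemma measurable_statD (R : realType) : measurable_fun setT (@statD R).
Proof. exact: measurable_funB. Qed.

Lemma statD_shear (R : realType) (b t s : R) : statD (shear R b (t, s)) = t.
Proof. by rewrite /statD/=; ring. Qed.

Lemma loss2_shear (R : realType) (W psi : R -> R) (th : R * R) (t s : R) :
  loss2 W th (equivariant psi (shear R th.2 (t, s))) = W (s - psi t).
Proof. by rewrite /loss2 /equivariant statD_shear/=; congr W; ring. Qed.

Lemma measurable_loss2 (R : realType) (W psi : R -> R) (th : R * R) :
  is_lossW W -> measurable_fun setT psi ->
  measurable_fun setT (fun x => loss2 W th (equivariant psi x)).
Proof.
move=> hW mpsi; apply: (measurableT_comp (lossW_measurable _ _ hW)).
apply: measurable_funB => //; apply: measurable_funB => //.
by apply: measurableT_comp => //; exact: measurable_statD.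
Qed.

(** * Comparison of the two estimators given D = [t] *)

Section conditional_comparison.
Variables (R : realType) (f : R * R -> R) (W psi : R -> R) (l u : R -> \bar R).
Variables (lam t : R).
Hypotheses (hf : is_pdf2 f) (hW : is_lossW W)
  (cW : cvg (W x @[x --> (0 : R)^'])) (tD : suppD f lam t).
Hypothesis hlu : forall m, is_cond_median f lam t m -> (l t <= m%:E <= u t)%E.
Hypothesis mWpsi : measurable
  [set s | W (s - psi_star l u psi t) < W (s - psi t)].

Lemma better_gt_half : ~~ (l t <= (psi t)%:E <= u t)%E ->
  ((2^-1)%:E * pdfD f lam t <
   \int[lebesgue_measure]_(s in
     [set s | (W (s - psi_star l u psi t) < W (s - psi t))%R]) slice R f lam t s)%E.
Proof.
have mg := measurable_slice _ _ hf lam t.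
have g0 := slice_ge0 _ _ hf lam t.
have /andP[p0 poo] := tD.
have pE : pdfD f lam t = (fine (pdfD f lam t))%:E.
  by rewrite fineK// ge0_fin_numE// ltW.
have pp : 0 < fine (pdfD f lam t) by rewrite fine_gt0// p0.
have mE m := cond_medianE _ _ hf lam t m tD.
set p := fine _ in pE pp mE.
(* [hlu] constrains the bounds only through an actual median; one exists, and it forces [l t <= u t]
   with a real number in between. *)
have [m0 hm0] : exists m, is_cond_median f lam t m.
  have [m hm] : exists m,
      (\int[lebesgue_measure]_(y in `]-oo, m]) slice R f lam t y = (p / 2)%:E)%E.
    apply: quantile_exists => //; first by rewrite divr_gt0.
    by rewrite -[ltRHS]/(pdfD f lam t) pE lte_fin ltr_pdivrMr// ltr_pMr// ltr1n.
  by exists m; apply/mE.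
have lmu := hlu _ hm0.
rewrite pE -EFinM mulrC negb_and -!ltNge => /orP[pl|up].
- have lE := psi_star_below _ _ _ _ _ _ lmu pl.
  set r := psi_star l u psi t in lE *.
  have pr : psi t < r by rewrite -lte_fin -lE.
  have [e e0 he] := lossW_lt_right _ _ _ _ hW cW pr.
  (* Every conditional median is at or above the clamped value [r], so the ray from [r - e] upwards
     has more than half of the mass. *)
  have hr m : is_cond_median f lam t m -> r <= m.
    by move=> /hlu /andP[+ _]; rewrite lE lee_fin.
  apply: lt_le_trans (integral_gt_half_right _ _ _ mg g0 pp pE r e e0 _) _.
    by move=> m /mE /hr.
  apply: ge0_subset_integral => //.
    exact: measurable_funTS.
  move=> s /=; rewrite in_itv/= andbT => /ltW; exact: he.
- have uE := psi_star_above _ _ _ _ _ _ lmu up.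
  set r := psi_star l u psi t in uE *.
  have pr : r < psi t by rewrite -lte_fin -uE.
  have [e e0 he] := lossW_lt_left _ _ _ _ hW cW pr.
  have hr m : is_cond_median f lam t m -> m <= r.
    by move=> /hlu /andP[_]; rewrite uE lee_fin.
  apply: lt_le_trans (integral_gt_half_left _ _ _ mg g0 pp pE r e e0 _) _.
    by move=> m /mE /hr.
  apply: ge0_subset_integral => //.
    exact: measurable_funTS.
Qed.

End conditional_comparison.

(** * Integration of the conditional comparison over the values of D *)

Theorem theorem3p2p1 (R : realType) (f : R * R -> R) (W : R -> R)
    (psi : R -> R) (l u : R -> \bar R)
    (hf : is_pdf2 f)
    (hW : is_lossW W)
    (hW0 : cvg (W x @[x --> (0 : R)^']))
    (hpsi : measurable_fun setT psi)
    (hl : measurable_fun setT l)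
    (hu : measurable_fun setT u)
    (hlu : forall lam t m : R, 0 <= lam -> suppD f lam t ->
       is_cond_median f lam t m -> (l t <= m%:E <= u t)%E)
    (hP : forall th : R * R, Theta0 th ->
       (Ptheta f th
          [set x | (l (statD x) <= (psi (statD x))%:E <= u (statD x))%E] < 1)%E) :
  forall th : R * R, Theta0 th ->
    ((2^-1)%:E < GPN f W (equivariant (psi_star l u psi)) (equivariant psi) th)%E.
Proof.
move=> th th12.
pose lam := th.2 - th.1; have lam0 : 0 <= lam by rewrite subr_ge0.
set d1 := equivariant (psi_star l u psi); set d2 := equivariant psi.
pose A := [set x | loss2 W th (d1 x) < loss2 W th (d2 x)].
pose E := [set x | loss2 W th (d1 x) = loss2 W th (d2 x)].
pose G := [set x : R * R | (l (statD x) <= (psi (statD x))%:E <= u (statD x))%E].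
have mpsis := measurable_psi_star _ _ _ _ hl hu hpsi.
have mloss1 := measurable_loss2 _ _ _ th hW mpsis.
have mloss2 := measurable_loss2 _ _ _ th hW hpsi.
have mA : measurable A by exact: measurable_lt_set.
have mE : measurable E by exact: measurable_eq_set.
have mD := measurable_statD R.
have mG : measurable G.
  rewrite (_ : G = [set x | (l (statD x) <= (psi (statD x))%:E)%E] `&`
      [set x | ((psi (statD x))%:E <= u (statD x))%E]).
    have mpD : measurable_fun setT (fun x : R * R => (psi (statD x))%:E).
      by apply/measurable_EFinP; exact: measurableT_comp.
    have mlD : measurable_fun setT (fun x : R * R => l (statD x)).
      exact: measurableT_comp.
    have muD : measurable_fun setT (fun x : R * R => u (statD x)).
      exact: measurableT_comp.
    by apply: measurableI; rewrite -[X in measurable X]setTI; exact: measurable_lee.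
  by apply/seteqP; split => x /= => [/andP[]|[? ?]]; [|apply/andP].
pose F S t := (\int[lebesgue_measure]_(s in [set s | S (shear R th.2 (t, s))])
  slice R f lam t s)%E.
have F0 S t : (0 <= F S t)%E by apply: integral_ge0 => s _; exact: slice_ge0.
have mF S : measurable S -> measurable_fun setT (F S).
  exact: measurable_fiber_integral.
have PF S : measurable S -> Ptheta f th S = (\int[lebesgue_measure]_t F S t)%E.
  exact: Ptheta_fiber.
have -> : GPN f W d1 d2 th =
    (\int[lebesgue_measure]_t (F A t + (2^-1)%:E * F E t))%E.
  rewrite /GPN !PF// [RHS]ge0_integralD//.
  - by rewrite ge0_integralZl_EFin ?invr_ge0//; exact: mF.
  - exact: mF.
  - by move=> t _; rewrite mule_ge0// ?lee_fin ?invr_ge0.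
  - by apply: measurable_funeM; exact: mF.
have mp := measurable_pdfD _ _ hf lam.
have p0 := pdfD_ge0 _ _ hf lam.
(* Writing [1/2] as an integral over [t] reduces the goal to comparing integrands. *)
have half : (\int[lebesgue_measure]_t ((2^-1)%:E * pdfD f lam t) = (2^-1)%:E)%E.
  by rewrite ge0_integralZl_EFin ?invr_ge0// integral_pdfD// mule1.
have FG S t (B : set R) : (forall s, B s <-> S (shear R th.2 (t, s))) ->
    F S t = (\int[lebesgue_measure]_(s in B) slice R f lam t s)%E.
  by move=> BS; rewrite /F (_ : [set s | _] = B)//; apply/seteqP; split => s /BS.
have Finside t S : (forall s, S (shear R th.2 (t, s))) -> F S t = pdfD f lam t.
  by move=> St; rewrite (FG _ _ setT).
have Fbad t : ~~ (l t <= (psi t)%:E <= u t)%E -> suppD f lam t ->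
    ((2^-1)%:E * pdfD f lam t < F A t)%E.
  move=> bad tD; rewrite (FG _ _ [set s | W (s - psi_star l u psi t) < W (s - psi t)]).
    apply: better_gt_half => //; first by move=> m; exact: hlu.
    by apply: measurable_lt_set; apply: (measurableT_comp (lossW_measurable _ _ hW));
      exact: measurable_funB.
  by move=> s; rewrite /A /mkset /d1 /d2 !loss2_shear.
have Fgood t : (l t <= (psi t)%:E <= u t)%E -> F E t = pdfD f lam t.
  by move=> good; apply: Finside => s; rewrite /E /mkset /d1 /d2 !loss2_shear psi_star_inside.
have aeF := ae_filter_ringOfSetsType (@lebesgue_measure R).
rewrite -[ltLHS]half; apply: ae_lt_integral.
- by apply: measurable_funeM; exact: mp.
- by apply: emeasurable_funD; [exact: mF|apply: measurable_funeM; exact: mF].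
- by move=> t; rewrite mule_ge0// ?lee_fin ?invr_ge0.
- by move=> t; rewrite adde_ge0// mule_ge0// ?lee_fin ?invr_ge0.
- by rewrite half ltry.
(* Almost everywhere inequality: for [psi t] within the bounds the tie alone contributes half of the
   density, and a zero density leaves nothing to prove. *)
- have := pdfD_ae_lty _ _ hf lam; apply: (@filterS _ _ aeF) => t poo.
  have [good|bad] := boolP (l t <= (psi t)%:E <= u t)%E.
    by rewrite Fgood// leeDr.
  have [p00|pn0] := eqVneq (pdfD f lam t) 0%E.
    by rewrite p00 mule0 adde_ge0// mule_ge0// ?lee_fin ?invr_ge0.
  have tD : suppD f lam t by apply/andP; rewrite lt0e pn0 p0.
  by rewrite (le_trans (ltW (Fbad t bad tD)))// leeDl// mule_ge0// ?lee_fin ?invr_ge0.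
(* Almost everywhere equality would leave only values [t] with [psi t] within the bounds or with
   zero density of D. In both cases [F G t] equals that density, so [G] would have probability one,
   against [hP]. *)
- move=> eqF; have := hP th th12; rewrite -/G PF// -(integral_pdfD _ _ hf lam).
  suff -> : (\int[lebesgue_measure]_t F G t = \int[lebesgue_measure]_t pdfD f lam t)%E.
    by rewrite ltxx.
  apply: ge0_ae_eq_integral => //; first exact: mF.
  move: eqF (pdfD_ae_lty _ _ hf lam); apply: (@filterS2 _ _ aeF) => t eqFt poo _.
  have [good|bad] := boolP (l t <= (psi t)%:E <= u t)%E.
    by apply: Finside => s; rewrite /G /mkset statD_shear.
  have [p00|pn0] := eqVneq (pdfD f lam t) 0%E.
    rewrite p00 (FG _ _ set0) ?integral_set0// => s.
    by rewrite /G /mkset statD_shear (negbTE bad); split.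
  have tD : suppD f lam t by apply/andP; rewrite lt0e pn0 p0.
  by have := Fbad t bad tD; rewrite ltNge eqFt leeDl// mule_ge0// ?lee_fin ?invr_ge0.
Qed.
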